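(* A combined non-degenerate finitely additive Markov chain on an arbitrary discrete space $(X,\Sigma_d)$, with Markov operator $A$, has no nonzero invariant countably additive measures, that is, $\Delta_{ca}=\emptyset$.
   Context: ''Arbitrary discrete space'' $(X,\Sigma_d)$: $X$ is an infinite set, $\Sigma_d=2^X$ is the sigma-algebra of all subsets of $X$, and the cardinality of $X$ is ''immeasurable'', meaning that every finite countably additive measure on $2^X$ that is zero on every one-point set is identically zero. $B(X,\Sigma_d)$ is the space of bounded $\Sigma_d$-measurable functions $X\to\mathbb R$. $ba(X,\Sigma_d)$ and $ca(X,\Sigma_d)$ are the spaces of bounded real-valued finitely additive, respectively countably additive, measures on $\Sigma_d$. A finitely additive measure $\mu\ge0$ is purely finitely additive if every countably additive measure $\lambda$ with $0\le\lambda\le\mu$ is identically zero; a signed measure is purely finitely additive if both components of its Jordan decomposition are. $pfa(X,\Sigma_d)$ is the space of bounded purely finitely additive measures. A finitely additive Markov chain is given by a finitely additive Markov kernel (transition function): a function $P(x,E)$, $x\in X$, $E\in\Sigma_d$, with $0\le P(x,E)\le1$, $P(\cdot,E)\in B(X,\Sigma_d)$ for all $E$, $P(x,\cdot)\in ba(X,\Sigma_d)$ and $P(x,X)=1$ for all $x$. Its Markov operator is $A:ba(X,\Sigma_d)\to ba(X,\Sigma_d)$, $A\mu(E)=\int_X P(x,E)\,\mu(dx)$ (Radon integral: the sup-norm continuous extension of the integral of simple functions). The kernel decomposes uniquely as $P(x,E)=P_{ca}(x,E)+P_{pfa}(x,E)$ with $P_{ca}(x,\cdot)\in ca(X,\Sigma_d)$,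 $P_{pfa}(x,\cdot)\in pfa(X,\Sigma_d)$ for all $x$. The chain is called combined if there are constants $0\le q_1,q_2\le1$, $q_1+q_2=1$, with $P_{ca}(x,X)=q_1$ and $P_{pfa}(x,X)=q_2$ for all $x\in X$; it is called non-degenerate if $0<q_1,q_2<1$. $\Delta_{ca}$ is the set of all nonzero nonnegative measures $\mu\in ca(X,\Sigma_d)$ with $\mu(X)\le1$ and $A\mu=\mu$. An invariant measure is a positive measure $\mu$ with $A\mu=\mu$. *)

(* Defs.v *)
From HB Require Import structures.
From mathcomp Require Import all_boot all_order all_algebra.
From mathcomp Require Import all_classical all_reals all_analysis.
Import Order.TTheory GRing.Theory Num.Theory.
Import numFieldNormedType.Exports.

Set Implicit Arguments.
Unset Strict Implicit.
Unset Printing Implicit Defensive.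

Local Open Scope classical_set_scope.
Local Open Scope ring_scope.

(* Bounded measures are real-valued set functions [mu : set X -> R]; only their
   values on measurable sets matter. The library's additivity predicates are
   stated for extended-real set functions, whence the [EFin \o mu]. *)

Definition discrete_sigma_algebra d (X : measurableType d) : Prop :=
  forall E : set X, measurable E.

Definition immeasurable (R : realType) d (X : measurableType d) : Prop :=
  forall mu : {finite_measure set X -> \bar R},
    (forall x : X, mu [set x] = 0%E) ->
    forall E : set X, measurable E -> mu E = 0%E.

Definition arbitrary_discrete_space (R : realType) d (X : measurableType d)
    : Prop :=
  [/\ infinite_set [set: X], discrete_sigma_algebra X & immeasurable R X].

Section measures.
Context (R : realType) d (X : measurableType d).
Implicit Types (mu nu lambda : set X -> R) (f : X -> R).

Definition in_B f : Prop :=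
  measurable_fun [set: X] f /\ exists M : R, forall x, `|f x| <= M.

Definition in_ba mu : Prop :=
  measure_function.semi_additive (EFin \o mu) /\
  exists M : R, forall E, measurable E -> `|mu E| <= M.

Definition in_ca mu : Prop := in_ba mu /\ semi_sigma_additive (EFin \o mu).

Definition nonneg_measure mu : Prop := forall E, measurable E -> 0 <= mu E.

Definition eq_measure mu nu : Prop := forall E, measurable E -> mu E = nu E.

Definition null_measure mu : Prop := forall E, measurable E -> mu E = 0.

Definition jordan_plus mu : set X -> R := fun E =>
  sup [set mu F | F in [set F | measurable F /\ F `<=` E]].

Definition jordan_minus mu : set X -> R := jordan_plus (fun E => - mu E).

Definition purely_fa_nonneg nu : Prop :=
  forall lambda, in_ca lambda ->
    (forall E, measurable E -> 0 <= lambda E <= nu E) -> null_measure lambda.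

(* If [mu >= 0], then on measurable sets [jordan_plus mu] is [mu] and
   [jordan_minus mu] is 0, so this extends [purely_fa_nonneg]. *)
Definition in_pfa mu : Prop :=
  [/\ in_ba mu, purely_fa_nonneg (jordan_plus mu) &
      purely_fa_nonneg (jordan_minus mu)].

Definition simple_function f : Prop :=
  measurable_fun [set: X] f /\ finite_set (range f).

Definition simple_integral mu f : R := fine (sintegral (EFin \o mu) f).

(* The limit of the integrals of simple functions [s] as [s] tends to [f] in
   the topology of uniform convergence. It exists when [mu] is in [ba] and [f]
   is in [B]; otherwise [lim] may return a meaningless value. *)
Definition radon_integral mu f : R :=
  lim (simple_integral mu s @[s --> within simple_function
                                      (nbhs (f : {uniform X -> R}))]).

Definition fa_markov_kernel (P : X -> set X -> R) : Prop :=
  [/\ forall x E, measurable E -> 0 <= P x E <= 1,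
      forall E, measurable E -> in_B (P^~ E),
      forall x, in_ba (P x) &
      forall x, P x [set: X] = 1].

Definition markov_operator (P : X -> set X -> R) mu : set X -> R :=
  fun E => radon_integral mu (P^~ E).

Definition kernel_decomposition (P Pca Ppfa : X -> set X -> R) : Prop :=
  [/\ forall x E, measurable E -> P x E = Pca x E + Ppfa x E,
      forall x, in_ca (Pca x) &
      forall x, in_pfa (Ppfa x)].

(* [Pca] and [Ppfa] exist and are unique by the Yosida-Hewitt theorem. *)
Definition combined (P : X -> set X -> R) (q1 q2 : R) : Prop :=
  [/\ 0 <= q1 <= 1, 0 <= q2 <= 1, q1 + q2 = 1 &
      exists Pca Ppfa : X -> set X -> R,
        [/\ kernel_decomposition P Pca Ppfa,
            forall x, Pca x [set: X] = q1 &
            forall x, Ppfa x [set: X] = q2]].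

Definition nondegenerate_weights (q1 q2 : R) : Prop := 0 < q1 < 1 /\ 0 < q2 < 1.

Definition invariant_measure (P : X -> set X -> R) mu : Prop :=
  nonneg_measure mu /\ eq_measure (markov_operator P mu) mu.

Definition Delta_ca (P : X -> set X -> R) : set (set X -> R) :=
  [set mu | [/\ in_ca mu, ~ null_measure mu, mu [set: X] <= 1 &
                invariant_measure P mu]].

End measures.

(* Main.v *)
Require Import Defs.
From HB Require Import structures.
From mathcomp Require Import all_boot all_order all_algebra finmap.
From mathcomp Require Import all_classical all_reals all_analysis.
From mathcomp Require Import measurable_realfun.
Import Order.TTheory GRing.Theory Num.Theory.
Import numFieldNormedType.Exports.

(** Let [mu] be a countably additive invariant measure. Each [P x] splits into
    a countably additive part of total mass [q1] and a purely finitely additive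
    part of mass [q2 > 0]. The second part is invisible on finite sets: a
    positive value on a point [y] would leave room for a multiple of the Dirac
    measure at [y] below it ([in_pfa_set1], [in_pfa_finite]). The first part is
    nonnegative, as its negative part would be a countably additive measure
    dominated by the purely finitely additive part ([ca_part_ge0]). Hence
    [P x F <= q1] for every finite [F], and integrating this bound gives
    [mu F = A mu F <= q1 * mu X].

    On the other hand, a countably additive measure on an immeasurable discrete
    space is carried by its countably many atoms, so that its total mass is the
    supremum of its values on finite sets ([immeasurable_le]). Therefore
    [mu X <= q1 * mu X] with [q1 < 1], and [mu X = 0].

    What remains is to handle the integral: for countably additive [mu], the
    Radon integral of a bounded function is its Lebesgue integral
    ([radon_integralE]), since the latter is Lipschitz in the sup norm and
    agrees with the elementary integral on simple functions. *)

Local Open Scope classical_set_scope.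
Local Open Scope ring_scope.

(** * Countably additive and purely finitely additive set functions *)

Section additive_set_functions.
Context {R : realType} {d : measure_display} {X : measurableType d}.
Implicit Types (mu nu : set X -> R).

Lemma in_ba_set0 mu : in_ba mu -> mu set0 = 0.
Proof.
move=> [mu_add _]; have := mu_add (fun=> set0) 0%N (fun=> measurable0).
rewrite !big_ord0 => mu0; apply: EFin_inj; apply: mu0 => //.
by move=> i j _ _ [x []].
Qed.

Lemma in_baU mu (A B : set X) : in_ba mu -> measurable A -> measurable B ->
  A `&` B = set0 -> mu (A `|` B) = mu A + mu B.
Proof.
move=> ba_mu mA mB AB0; have [mu_add _] := ba_mu.
have mu0 : (EFin \o mu) set0 = 0%E by rewrite /= in_ba_set0.
by have [] := (additive2P mu0).1 mu_add A B mA mB AB0.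
Qed.

Lemma in_baN mu : in_ba mu -> in_ba (fun E => - mu E).
Proof.
move=> [mu_add [M muM]]; split; last first.
  by exists M => E mE; rewrite normrN muM.
move=> F n mF tF mUF; have /= := mu_add F n mF tF mUF.
by rewrite sumEFin /= => -[->]; rewrite sumEFin sumrN.
Qed.

Lemma jordan_plus_ge mu (E F : set X) : in_ba mu ->
  measurable F -> F `<=` E -> mu F <= jordan_plus mu E.
Proof.
move=> [_ [M muM]] mF FE; apply: ub_le_sup; last by exists F.
by exists M => _ [G [mG _] <-]; exact: le_trans (ler_norm _) (muM G mG).
Qed.

(** Gives access to the Hahn decomposition. *)
Lemma charge_of_in_ca mu : in_ca mu ->
  exists nu : {charge set X -> \bar R}, EFin \o mu = nu :> (set X -> \bar R).
Proof.
move=> [ba_mu mu_sigma].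
have mu0 : (EFin \o mu) set0 = 0%E by rewrite /= in_ba_set0.
have mu_fin E : measurable E -> (EFin \o mu) E \is a fin_num by [].
pose mixin := isCharge.Build d X R (EFin \o mu) mu0 mu_fin mu_sigma.
pose nu : {charge set X -> \bar R} := HB.pack (EFin \o mu) mixin.
by exists nu.
Qed.

Lemma in_ca_of_charge mu (nu : {charge set X -> \bar R}) (M : R) :
  EFin \o mu = nu :> (set X -> \bar R) ->
  (forall E, measurable E -> `|mu E| <= M) -> in_ca mu.
Proof.
move=> mu_nu muM; rewrite /in_ca /in_ba mu_nu.
by split; [split; [exact: charge_semi_additive | exists M]
          | exact: charge_semi_sigma_additive].
Qed.

Lemma finite_measure_of_in_ca mu : in_ca mu -> (forall E, 0 <= mu E) ->
  exists m : {finite_measure set X -> \bar R},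
    EFin \o mu = m :> (set X -> \bar R).
Proof.
move=> [ba_mu mu_sigma] mu_ge0.
have mu0 : (EFin \o mu) set0 = 0%E by rewrite /= in_ba_set0.
have mu_fin : fin_num_fun (EFin \o mu) by [].
have emu_ge0 E : (0 <= (EFin \o mu) E)%E by rewrite /= lee_fin.
pose mix1 := isMeasure.Build d X R (EFin \o mu) mu0 emu_ge0 mu_sigma.
pose m1 : {measure set X -> \bar R} := HB.pack (EFin \o mu) mix1.
pose mix2 := Measure_isFinite.Build d X R m1 mu_fin.
pose m : {finite_measure set X -> \bar R} := HB.pack (EFin \o mu) m1 mix2.
by exists m.
Qed.

(** If [nu [set y]] were positive, [nu [set y]] times the Dirac measure at [y]
    would be a nonzero countably additive measure below [jordan_plus nu]. *)
Lemma purely_fa_set1_le0 nu (y : X) : in_ba nu -> measurable [set y] ->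
  purely_fa_nonneg (jordan_plus nu) -> nu [set y] <= 0.
Proof.
move=> ba_nu my pfa_nu; rewrite leNgt; apply/negP => nuy_gt0.
pose lam (E : set X) : R := nu [set y] * \1_E y.
have lam_ca : in_ca lam.
  apply: (@in_ca_of_charge lam
    (cscale (nu [set y]) (charge_of_finite_measure (dirac y))) (nu [set y])).
    by [].
  move=> E _; rewrite /lam indicE normrM (gtr0_norm nuy_gt0).
  rewrite ler_piMr//; first exact: ltW.
  by rewrite normr_nat lern1 leq_b1.
have lam_le E : measurable E -> 0 <= lam E <= jordan_plus nu E.
  move=> mE; rewrite /lam indicE; have [yE|yE] := boolP (y \in E).
    rewrite mulr1 ltW//=; apply: jordan_plus_ge => // _ ->.
    by rewrite inE in yE.
  by rewrite mulr0 lexx /= -(in_ba_set0 _ ba_nu) jordan_plus_ge.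
have /eqP := pfa_nu _ lam_ca lam_le _ my.
by rewrite /lam indicE mem_set// mulr1 gt_eqF.
Qed.

(** The previous lemma applies to both [nu] and [- nu], as [jordan_minus nu] is
    [jordan_plus] of [- nu]. *)
Lemma in_pfa_set1 nu (y : X) : in_pfa nu -> measurable [set y] ->
  nu [set y] = 0.
Proof.
move=> [ba_nu pfap pfam] my; apply/eqP; rewrite eq_le.
rewrite purely_fa_set1_le0//= -oppr_le0.
exact: (purely_fa_set1_le0 _ _ (in_baN _ ba_nu)).
Qed.

Lemma in_pfa_finite nu (F : set X) : in_pfa nu ->
  (forall E : set X, finite_set E -> measurable E) -> finite_set F -> nu F = 0.
Proof.
move=> pfa_nu mfin /finite_seqP[s ->]; have [ba_nu _ _] := pfa_nu.
elim: s => [|y s IHs]; first by rewrite set_nil in_ba_set0.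
have -> : [set` y :: s] = y |` [set` s].
  by apply/seteqP; split => z /=; rewrite inE => /predU1P.
have [ys|ys] := boolP (y \in s).
  by have -> : y |` [set` s] = [set` s] by apply/setUidPr => _ ->.
rewrite in_baU//; try exact: mfin.
  by rewrite IHs in_pfa_set1 ?addr0//; exact: mfin.
by apply/seteqP; split => // z [/= ->]; rewrite (negbTE ys).
Qed.

(** Let [N] be a negative set of a Hahn decomposition of [ca]. On [N], the
    nonnegativity of [mu] forces [- ca <= pfa], so the restriction of [- ca] to
    [N] is a countably additive measure below [jordan_plus pfa]; it vanishes by
    pure finite additivity. *)
Lemma ca_part_ge0 mu ca pfa : nonneg_measure mu ->
  (forall E, measurable E -> mu E = ca E + pfa E) ->
  in_ca ca -> in_pfa pfa -> nonneg_measure ca.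
Proof.
move=> mu_ge0 mu_dec ca_ca [ba_pfa pfap _].
have [nu ca_nu] := charge_of_in_ca _ ca_ca.
have [P [N [[mP posP] [mN negN] PN_T PN_0]]] := Hahn_decomposition nu.
have nuE E : nu E = (ca E)%:E by rewrite -ca_nu.
have [[_ [M caM]] _] := ca_ca.
pose lam E := - ca (E `&` N).
have lam_ca : in_ca lam.
  apply: (@in_ca_of_charge lam (copp (crestr nu mN)) M).
    by apply/funext => E; rewrite -[RHS]/(- nu (E `&` N))%E nuE.
  by move=> E mE; rewrite normrN caM//; exact: measurableI.
have lam_le E : measurable E -> 0 <= lam E <= jordan_plus pfa E.
  move=> mE; have mEN : measurable (E `&` N) by exact: measurableI.
  apply/andP; split.
    by rewrite oppr_ge0 -lee_fin -nuE negN//; exact: subIsetr.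
  apply: le_trans (jordan_plus_ge _ _ _ ba_pfa mEN (@subIsetl _ _ _)).
  by rewrite /lam -subr_ge0 opprK addrC -mu_dec// mu_ge0.
move=> E mE; have /eqP := pfap _ lam_ca lam_le E mE.
rewrite oppr_eq0 => /eqP caEN.
have -> : E = (E `&` P) `|` (E `&` N) by rewrite -setIUr PN_T setIT.
rewrite in_baU; [|exact: ca_ca.1|exact: measurableI|exact: measurableI|].
  rewrite caEN addr0 -lee_fin -nuE posP//; exact: measurableI.
by rewrite setIACA PN_0 setI0.
Qed.

End additive_set_functions.

(** * The Radon integral against a countably additive measure *)

Section radon_integrals.
Context {R : realType} {d : measure_display} {X : measurableType d}.
Context (mu : set X -> R) (m : {finite_measure set X -> \bar R}).
Context (mu_m : EFin \o mu = m :> (set X -> \bar R)).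

Lemma in_B_integrable (f : X -> R) : in_B f ->
  m.-integrable [set: X] (EFin \o f).
Proof.
move=> [mf [M fM]]; apply: measurable_bounded_integrable => //.
  by rewrite ltey_eq fin_num_measure.
exists M; split; first exact: num_real.
by move=> N MN x _; exact: le_trans (fM x) (ltW MN).
Qed.

Lemma simple_function_in_B (s : X -> R) : simple_function s -> in_B s.
Proof.
move=> [ms fs]; split=> //.
have [M [_ sM]] := compact_bounded (finite_compact fs).
exists (M + 1) => x; apply: (sM (M + 1)); first by rewrite ltrDl.
by exists x.
Qed.

Lemma simple_integralE (s : X -> R) : simple_function s ->
  simple_integral mu s = \int[m]_x s x.
Proof.
move=> [ms fs]; rewrite /simple_integral mu_m /Rintegral; congr fine.
have level_meas y : measurable (s @^-1` [set y]).
  by rewrite -[_ @^-1` _]setTI; exact: ms.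
have level_int y : m.-integrable [set: X]
    (fun x => y%:E * (\1_(s @^-1` [set y]) x)%:E)%E.
  by apply: integrableZl => //; exact: integrable_indic.
rewrite sintegralE fsbig_finite//=.
under [RHS]eq_integral => x _.
  have -> : (s x)%:E = (\sum_(y <- fset_set (range s))
      y%:E * (\1_(s @^-1` [set y]) x)%:E)%E.
    rewrite (bigD1_seq (s x)) ?fset_uniq//=; last first.
      by rewrite in_fset_set// inE; exists x.
    rewrite indicE mem_set// mule1 big1 ?adde0// => y yx.
    by rewrite indicE memNset ?mule0// => /= /esym/eqP; exact/negP.
  over.
rewrite integral_sum//; apply: eq_bigr => y _.
rewrite integralZl//; last exact: integrable_indic.
by rewrite integral_indic// setIT.
Qed.

(** Rounding [f] down to a multiple of [e], after the shift by a bound [M] that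
    makes it nonnegative, leaves finitely many values. *)
Lemma simple_function_dense (f : X -> R) (e : R) : in_B f -> 0 < e ->
  exists2 s, simple_function s & forall x, `|f x - s x| < e.
Proof.
move=> [mf [M fM]] e0; pose g x := (f x + M) / e.
have g_ge0 x : 0 <= g x.
  apply: divr_ge0 (ltW e0); rewrite -lerBlDr sub0r.
  by have := fM x; rewrite ler_norml => /andP[].
pose s x := (Num.trunc (g x))%:R * e - M.
exists s.
  split.
    pose h (r : R) : R := (Num.trunc ((r + M) / e))%:R * e - M.
    have mh : measurable_fun [set: R] h.
      apply: nondecreasing_measurable => // r t rt.
      rewrite lerD2r ler_pM2r// ler_nat Num.Theory.le_truncn//.
      by rewrite ler_pM2r ?invr_gt0// lerD2r.
    exact: (measurableT_comp mh mf).
  pose N := Num.trunc ((M + M) / e).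
  apply: (@sub_finite_set _ _ ((fun k => k%:R * e - M) @` `I_N.+1)).
    move=> _ [x _ <-]; exists (Num.trunc (g x)) => //=.
    rewrite ltnS /N Num.Theory.le_truncn// ler_pM2r ?invr_gt0//.
    by rewrite lerD2r; apply: le_trans (fM x); exact: ler_norm.
  exact/finite_image/finite_II.
move=> x; have /andP[lo hi] := Num.Theory.truncn_itv (g_ge0 x).
have -> : f x = g x * e - M by rewrite /g divfK ?gt_eqF// addrK.
rewrite /s opprB addrA subrK -mulrBl normrM (gtr0_norm e0) gtr_pMl//.
by rewrite ger0_norm ?subr_ge0// ltrBlDr -natr1 addrC in hi *.
Qed.

(** The difference of the integrals of [f] and of a simple function [s] is at
    most the sup-norm distance of [f] and [s] times [m [set: X]]. Density of the
    simple functions is also needed: it makes the filter defining the Radon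
    integral proper, so that the limit is unique. *)
Lemma radon_integralE (f : X -> R) : in_B f ->
  radon_integral mu f = \int[m]_x f x.
Proof.
move=> Bf; have f_int := in_B_integrable _ Bf.
rewrite /radon_integral.
have entE (e : R) : 0 < e ->
    entourage [set rs : R * R | `|rs.1 - rs.2| < e].
  by move=> e0; rewrite -entourage_from_ballE; exists e.
have f_cl : closure (@simple_function R d X : set {uniform X -> R}) f.
  move=> U /uniform_nbhs[E [+ EU]].
  rewrite -entourage_from_ballE => -[e /= e0 eE].
  have [s ss fs] := simple_function_dense _ _ Bf e0.
  by exists s; split=> //; apply: EU => x _; apply: eE; exact: fs.
have proper := @within_nbhs_proper {uniform X -> R} _ _ f_cl.
apply: cvg_lim; first exact: Rhausdorff.
apply/cvgrPdist_le => e e0; rewrite near_withinE.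
(* The added 1 keeps [c] positive when [m] is zero. *)
pose c := fine (m [set: X]) + 1.
have c0 : 0 < c by rewrite ltr_wpDl// fine_ge0.
apply/uniform_nbhs; exists [set rs : R * R | `|rs.1 - rs.2| < e / c].
split; first by apply: entE; exact: divr_gt0.
move=> s /= fs ss; rewrite simple_integralE//.
have s_int := in_B_integrable _ (simple_function_in_B _ ss).
rewrite -RintegralB//.
have fs_int : m.-integrable [set: X] (EFin \o (fun x => f x - s x)).
  exact: (integrableB measurableT f_int s_int).
apply: le_trans (le_normr_Rintegral _ fs_int) _ => //.
have -> : e = e / c * c by rewrite divfK// gt_eqF.
apply: (@le_trans _ _ (\int[m]_x (cst (e / c) x))).
  apply: le_Rintegral => //.
  - exact: (integrable_norm fs_int).
  - exact: finite_measure_integrable_cst.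
  - by move=> x _; exact/ltW/fs.
rewrite Rintegral_cst// ler_pM2l ?divr_gt0//.
by rewrite /c lerDl.
Qed.

End radon_integrals.

(** * Finite measures on immeasurable discrete spaces *)

Section immeasurable_spaces.
Context {R : realType} {d : measure_display} {X : measurableType d}.
Context (m : {finite_measure set X -> \bar R}).
Context (X_discrete : discrete_sigma_algebra X).

Lemma measure_fset_ge (B : {fset X}) (e : R) :
  (forall x, x \in B -> (e%:E <= m [set x])%E) ->
  (((#|` B|)%:R * e)%:E <= m [set` B])%E.
Proof.
move=> eB.
have -> : [set` B] = \bigcup_(x in [set` B]) [set x].
  by rewrite bigcup_imset1 image_id.
rewrite measure_fin_bigcup//; last first.
  by move=> x y _ _ [z [/= -> ->]].
rewrite fsbig_finite//= set_fsetK mulr_natl.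
have -> : e *+ #|` B| = \sum_(x <- B) e.
  by rewrite big_const_seq count_predT iter_addr_0.
rewrite -sumEFin big_seq [leRHS]big_seq.
exact: lee_sum.
Qed.

Definition atoms_ge (n : nat) : set X :=
  [set x | (n.+1%:R^-1%:E <= m [set x])%E].

(** [k] points of mass at least [1 / n.+1] form a finite set of mass at least
    [k / n.+1], so there are at most [c * n.+1] of them. *)
Lemma finite_atoms_ge (c : R) n :
  (forall F, finite_set F -> (m F <= c%:E)%E) -> finite_set (atoms_ge n).
Proof.
move=> m_le; apply: contrapT.
move=> /(infinite_set_fset (Num.trunc (c * n.+1%:R)).+1)[B BA cardB].
have := measure_fset_ge B n.+1%:R^-1 (fun x xB => BA x xB).
move=> /le_trans/(_ (m_le _ (finite_fset B))).
rewrite lee_fin ler_pdivrMr// => leB.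
have := le_trans _ leB; move=> /(_ (Num.trunc (c * n.+1%:R)).+1%:R).
by rewrite ler_nat cardB => /(_ isT); rewrite leNgt Num.Theory.truncnS_gt.
Qed.

(** The measure restricted to the complement of its set [D] of atoms charges no
    point, hence is zero by immeasurability; and [D] is the increasing union of
    the finite sets [atoms_ge n], along which the measure is continuous. *)
Lemma immeasurable_le (c : R) : immeasurable R X ->
  (forall F, finite_set F -> (m F <= c%:E)%E) -> (m [set: X] <= c%:E)%E.
Proof.
move=> X_imm m_le.
pose D := \bigcup_n atoms_ge n.
have mD : measurable D by exact: X_discrete.
have mDC : measurable (~` D) by exact: X_discrete.
have mDoo : (m (~` D) < +oo)%E by rewrite ltey_eq fin_num_measure.
have DC0 : m (~` D) = 0%E.
  have restrE E : mfrestr mDC mDoo E = m (E `&` ~` D) by [].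
  rewrite -[~` D]setTI -restrE; apply: X_imm => // x.
  rewrite -[LHS]/(m ([set x] `&` ~` D)).
  have [xD|xD] := pselect (D x).
    rewrite (_ : _ `&` _ = set0) ?measure0//.
    by apply/seteqP; split => // y [/= ->].
  have -> : [set x] `&` ~` D = [set x] by apply/setIidPl => _ ->.
  apply/eqP; rewrite eq_le measure_ge0 andbT leNgt; apply/negP => mx_gt0.
  have mx_fin : m [set x] \is a fin_num by exact: fin_num_measure.
  have fmx_gt0 : 0 < fine (m [set x]).
    by rewrite fine_gt0// mx_gt0 ltey_eq mx_fin.
  have [n _ /(_ n (leqnn n)) /= n_lt] := near_infty_natSinv_lt (PosNum fmx_gt0).
  by apply: xD; exists n => //; rewrite /atoms_ge/= -(fineK mx_fin) lee_fin ltW.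
have -> : m [set: X] = m D.
  have := measureDI m measurableT mD; rewrite setTD setTI => ->.
  by rewrite [X in (X + _)%E]DC0 add0e.
have nd : nondecreasing_seq atoms_ge.
  move=> n k nk; apply/subsetPset => x /=; apply: le_trans.
  by rewrite lee_fin lef_pV2 ?posrE// ler_nat.
have cvgD : m \o atoms_ge @ \oo --> m D.
  by apply: nondecreasing_cvg_mu => // n; exact: X_discrete.
rewrite -(cvg_lim (@ereal_hausdorff R) cvgD); apply: lime_le.
  by apply/cvg_ex; eexists; exact: cvgD.
by apply: nearW => n; exact: m_le (finite_atoms_ge _ _ m_le).
Qed.

End immeasurable_spaces.

(** * Invariant measures of a combined chain *)

Theorem theorem4p3 (R : realType) (d : measure_display) (X : measurableType d)
    (hX : arbitrary_discrete_space R X)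
    (P : X -> set X -> R) (hP : fa_markov_kernel P)
    (q1 q2 : R) (hcomb : combined P q1 q2) (hnd : nondegenerate_weights q1 q2) :
  (forall mu : set X -> R,
     in_ca mu -> invariant_measure P mu -> null_measure mu) /\
  Delta_ca P = set0.
Proof.
suff inv0 mu : in_ca mu -> invariant_measure P mu -> null_measure mu.
  split=> //; apply/seteqP; split=> // mu [mu_ca mu_neq0 _ mu_inv].
  exact/mu_neq0/inv0.
move=> mu_ca [mu_ge0 mu_inv].
have [_ X_discrete X_imm] := hX.
have [P01 PB _ _] := hP.
have [_ _ _ [Pca [Ppfa [[P_dec Pca_ca Ppfa_pfa] Pca_X _]]]] := hcomb.
have [/andP[_ q1_lt1] _] := hnd.
have [m mu_m] := finite_measure_of_in_ca _ mu_ca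
  (fun E => mu_ge0 E (X_discrete E)).
have mE E : m E = (mu E)%:E by rewrite -mu_m.
have P_finite x F : finite_set F -> P x F <= q1.
  move=> finF.
  have Pca_ge0 : nonneg_measure (Pca x).
    apply: (ca_part_ge0 (P x) _ (Ppfa x)) => // E mEE.
    - by have /andP[] := P01 x E mEE.
    - exact: P_dec.
  rewrite P_dec// (in_pfa_finite (Ppfa x))// addr0 -(Pca_X x).
  rewrite -(setUv F) in_baU ?lerDl ?setICr//; first exact: Pca_ge0.
  by have [] := Pca_ca x.
have mu_finite F : finite_set F -> (m F <= (q1 * mu setT)%:E)%E.
  move=> finF; rewrite mE lee_fin -mu_inv//.
  rewrite /markov_operator (radon_integralE _ m)//; last exact: PB.
  have -> : mu setT = fine (m setT) by rewrite mE.
  rewrite -Rintegral_cst//; apply: le_Rintegral => //.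
  - by apply: in_B_integrable; exact: PB.
  - exact: finite_measure_integrable_cst.
  - by move=> x _; exact: P_finite.
have := immeasurable_le m X_discrete _ X_imm mu_finite.
rewrite mE lee_fin -subr_ge0 -{2}(mul1r (mu setT)) -mulrBl.
rewrite nmulr_rge0 ?subr_lt0// => mu_le0.
move=> E mEE; apply/eqP; rewrite eq_le mu_ge0// andbT.
apply: le_trans mu_le0; rewrite -lee_fin -!mE.
by apply: le_measure; rewrite ?inE.
Qed.
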